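(* Let a topological group $G$ be $\tau_g$-representable in locally compact spaces $Y$ and $X$, let $f: Y\to X$ be a perfect onto $G$-map, and let $b_Y G$ be a graph compactification of $G$. (A) $b_X G$ is a graph compactification of $G$ and $b_Y G\geq b_X G$ if and only if the following condition (PM) holds: for all $g\in G$ and all $R\in b_Y G$, if $F^H(\imath_Y^{\Gamma}(g))=F^H(R)$, then $\imath_Y^{\Gamma}(g)=R$. (B) Suppose additionally that $f$ is an elementary map, with $K=f^{-1}(x)$ for some $x\in X$ and $|f^{-1}(x')|=1$ for all $x'\ne x$. Then the set $$0_K=\{R\in b_Y G\mid R\subset (Y\times K)\cup(K\times Y)\}$$ is invariant under the action $\theta^H_{Y\uparrow}$ and the self-inverse map $S_Y$ (and hence is invariant under the action $\theta^H_{Y\rightarrow}$). Moreover, [$b_X G$ is a graph compactification of $G$, $b_Y G\ge b_X G$, and the map of compactifications $F^H|_{b_Y G}:b_Y G\to b_X G$ is elementary ($F^H|_{b_Y G\setminus 0_K}$ is a bijection onto its image)] if and only if the following condition (EPM) holds: for all $R,S\in b_Y G$, - if $R\cap((Y\setminus K)\times(Y\setminus K))=S\cap((Y\setminus K)\times(Y\setminus K))\neq\emptyset$ and $F^H(R)=F^H(S)$, then $R=S$; and - if $R\cap((Y\setminus K)\times(Y\setminus K))=S\cap((Y\setminus K)\times(Y\setminus K))=\emptyset$, then $F^H(R)=F^H(S)$.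
   Context: All spaces are Tychonoff; maps are continuous; actions are effective. A $G$-map is an equivariant continuous map. An onto quotient map is elementary if the preimages of all points, except maybe one, are one-point sets. An equiuniformity on a $G$-space $X$ is a uniformity $\mathcal U$ inducing the topology of $X$ such that every $g\in G$ is uniformly continuous and for every uniform cover $u\in\mathcal U$ there are a neighbourhood $O$ of $e\in G$ and $v\in\mathcal U$ such that $\{OV\mid V\in v\}$ refines $u$. $X$ is $G$-Tychonoff if it has an equiuniformity. A group $G$ is representable in $X$ if it is a subgroup of the homeomorphism group of $X$. The $g$-topology $\tau_g$ on $G$ has as subbase the sets $[K,O]=\{g\in G\mid gK\subset O\}$, $K$ closed, $O$ open in $X$, with $K$ compact or $X\setminus O$ compact. A topological group $(G,\tau)$ is $\tau_g$-representable in $X$ if $G$ is representable in $X$, $\tau=\tau_g$, and $X$ is a $G$-Tychonoff space under the natural action. $2^{X\times X}$ is the set of all closed subsets of $X\times X$ (including $\emptyset$) with the Fell topology $\tau_F$, whose subbase is all sets $\{F\mid F\cap W\neq\emptyset\}$, $W$ open, and $\{F\mid F\cap K=\emptyset\}$, $K$ compact; it is compact Hausdorff for locally compact $X$. Put $\imath_X^{\Gamma}(g)=\{(x,gx)\mid x\in X\}$, and let $b_XG$ be the closure of $\imath_X^{\Gamma}(G)$ in $(2^{X\times X},\tau_F)$. If $\imath_X^{\Gamma}$ is a topological embedding of $G$, $b_XG$ is called a graph compactification of $G$. Same notation for $Y$. For compactifications $(b'G,b')$, $(bG,b)$ of $G$: $b'G\ge bG$ iff there is a continuous $\varphi:b'G\to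 bG$ (the map of compactifications) with $\varphi\circ b'=b$. $F^H:2^{Y\times Y}\to 2^{X\times X}$, $F^H(R)=(f\times f)(R)$. $S_Y(R)=\{(y,x)\mid(x,y)\in R\}$, $\theta^H_{Y\uparrow}(g,R)=\{(x,gy)\mid(x,y)\in R\}$, $\theta^H_{Y\rightarrow}(g,R)=\{(gx,y)\mid(x,y)\in R\}$ for $R\in 2^{Y\times Y}$.
   Formalization: In (B), invariance of 0_K is claimed only if K has more than one point or x is fixed by G (false in general otherwise), and ''elementary'' for F^H on b_Y G means elementary, injective off 0_K and also constant on 0_K (without constancy the equivalence with (EPM) fails). *)

(* Defs.v *)
From HB Require Import structures.
From mathcomp Require Import all_boot all_order all_algebra.
From mathcomp Require Import all_classical all_reals all_analysis.

Set Implicit Arguments.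
Unset Strict Implicit.
Unset Printing Implicit Defensive.

Local Open Scope classical_set_scope.

HB.mixin Record isTychonoff T & Topological T := {
  tychonoff_hausdorff : hausdorff_space T;
  tychonoff_completely_regular : completely_regular_space T }.

#[short(type="tychonoffType")]
HB.structure Definition Tychonoff := {T of Topological T & isTychonoff T}.

HB.mixin Record isTopGroup G & Group G & Topological G := {
  topgroup_mul_continuous : continuous (fun p : G * G => (p.1 * p.2)%g);
  topgroup_inv_continuous : continuous (fun g : G => g^-1%g) }.

#[short(type="topGroupType")]
HB.structure Definition TopGroup :=
  {G of Group G & Tychonoff G & isTopGroup G}.

(* G as a subgroup of the homeomorphism group of X: an injective homomorphism
   into it (each [rep_act g] is a homeomorphism with inverse
   [rep_act g^-1]). *)
Record rep (G : topGroupType) (X : tychonoffType) := Rep {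
  rep_act :> G -> X -> X;
  rep_act1 : forall x, rep_act 1%g x = x;
  rep_actM : forall g h x, rep_act (g * h)%g x = rep_act g (rep_act h x);
  rep_continuous : forall g, continuous (rep_act g);
  rep_inj : injective rep_act }.

(* The carrier of G with the g-topology; the subbase is indexed by its own
   members. *)
Definition gtop (G : topGroupType) (X : tychonoffType) (r : rep G X) : Type :=
  G.

Definition gtop_subbase (G : topGroupType) (X : tychonoffType) (r : rep G X) :
    set_system G :=
  [set A | exists K O : set X,
    [/\ closed K, open O, compact K \/ compact (~` O)
      & A = [set g | r g @` K `<=` O]]].

Section gtop_instances.
Context (G : topGroupType) (X : tychonoffType) (r : rep G X).
HB.instance Definition _ := Choice.copy (gtop r) G.
HB.instance Definition _ :=
  isSubBaseTopological.Build (gtop r) (gtop_subbase r) id.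
End gtop_instances.

Definition uniform_cover (U : uniformType) (u : set (set U)) :=
  exists2 E, entourage E & forall x : U, exists2 A, u A & xsection E x `<=` A.

Definition refines (T : Type) (v u : set (set T)) :=
  forall V, v V -> exists2 A, u A & V `<=` A.

Section equiuniformity.
Context (G : topGroupType) (X : tychonoffType) (r : rep G X).

(* Equiuniformities, given by entourages; the covering uniformity consists of
   the uniform covers *)
Definition equiuniformity (uX : Uniform.axioms_ X) :=
  let U : uniformType := Uniform.Pack uX in
  [/\ forall x : X, @nbhs U U x = @nbhs X X x,
      forall g, @unif_continuous U U (r g) &
      forall u, @uniform_cover U u ->
        exists (O : set G) (v : set (set X)),
          [/\ nbhs (1%g : G) O, @uniform_cover U v &
              refines [set [set r z.1 z.2 | z in O `*` V] | V in v] u]].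

Definition G_tychonoff :=
  continuous (fun z : G * X => r z.1 z.2) /\ exists uX, equiuniformity uX.

Definition taug_representable :=
  @open G = @open (gtop r) /\ G_tychonoff.

End equiuniformity.

(* 2^T with the Fell topology *)
Record hyperspace (T : topologicalType) := Hyperspace {
  hset :> set T;
  hset_closed : closed hset }.

Definition fell_subbase (T : topologicalType) : set_system (hyperspace T) :=
  [set A | exists2 W : set T, open W &
     A = [set F : hyperspace T | F `&` W !=set0]] `|`
  [set A | exists2 K : set T, compact K &
     A = [set F : hyperspace T | F `&` K = set0]].

Section fell_topology.
Context (T : topologicalType).
HB.instance Definition _ := gen_eqMixin (hyperspace T).
HB.instance Definition _ := gen_choiceMixin (hyperspace T).
HB.instance Definition _ :=
  isSubBaseTopological.Build (hyperspace T) (@fell_subbase T) id.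
End fell_topology.

Lemma hyperspace_eq (T : topologicalType) (A B : hyperspace T) :
  hset A = hset B -> A = B.
Proof.
case: A B => [A cA] [B cB] /= AB; subst B.
by congr Hyperspace; exact: Prop_irrelevance.
Qed.

Definition embedding (S T : topologicalType) (i : S -> T) :=
  [/\ injective i, continuous i &
      forall U, open U -> exists2 V, open V & U = i @^-1` V].

Definition quotient_map (S T : topologicalType) (q : S -> T) :=
  [/\ continuous q, set_surj setT setT q &
      forall V : set T, open (q @^-1` V) -> open V].

Definition elementary (S T : topologicalType) (q : S -> T) :=
  quotient_map q /\ is_subset1 [set t | ~ exists! s, q s = t].

(* Elementary, with Z in the role of the exceptional fibre: q is one-to-one off
   Z and collapses Z.  The last clause does not follow from the first two: a
   bijection is elementary, however large Z is. *)
Definition elementary_with_fibre (S T : topologicalType) (q : S -> T)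
    (Z : set S) :=
  [/\ elementary q, set_inj (~` Z) q & is_subset1 (q @` Z)].

Definition perfect_map (S T : topologicalType) (f : S -> T) :=
  [/\ continuous f, forall A, closed A -> closed (f @` A) &
      forall t, compact (f @^-1` [set t])].

(* K and K' are intended to be compactifications of G, with embeddings b
   and b' *)
Definition comp_map (G : Type) (K K' : topologicalType) (b : G -> K)
    (b' : G -> K') (phi : K -> K') :=
  continuous phi /\ forall g, phi (b g) = b' g.

Definition comp_ge (G : Type) (K K' : topologicalType) (b : G -> K)
    (b' : G -> K') := exists phi, comp_map b b' phi.

Lemma graph_closed (S T : topologicalType) (h : S -> T) :
  hausdorff_space T -> continuous h -> closed [set (x, h x) | x in setT].
Proof.
move=> hT ch [a b] clab; exists a => //; congr pair; apply: hT => U V hU bV.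
have [_ [/= [x _ <-] [/= Ux Vx]]] :
    ([set (x, h x) | x in setT] `&` ((h @^-1` U) `*` V)) !=set0.
  by apply: clab; exists (h @^-1` U, V) => //; split => //; exact: ch.
by exists (h x).
Qed.

Lemma perfect_tube (S T : topologicalType) (f : S -> T) (t : T) (U : set S) :
  perfect_map f -> (forall s, f s = t -> nbhs s U) -> nbhs t [set t' |
    forall s, f s = t' -> U s].
Proof.
move=> [_ fcl _] tU.
have oN : open (~` (f @` (~` U°))).
  by rewrite openC; apply: fcl; rewrite closedC; exact: open_interior.
apply: (@filterS _ _ _ (~` (f @` (~` U°)))); last first.
  by apply: open_nbhs_nbhs; split => //= -[s nUs /tU].
move=> t' nt' s fs; apply: interior_subset; apply: contrapT => nUs.
by apply: nt'; exists s.
Qed.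

Lemma perfect_id_closed (S T Z : topologicalType) (f : S -> T)
    (R : set (S * Z)) : perfect_map f -> closed R ->
  closed [set (f p.1, p.2) | p in R].
Proof.
move=> pf; have [_ _ fcpt] := pf; move=> cR [t z] cltz; apply: contrapT => nR.
pose P (W : set Z) (s : S) :=
  nbhs s [set s' | forall z', W z' -> ~ R (s', z')].
have nP : \forall W \near powerset_filter_from (nbhs z),
    f @^-1` [set t] `<=` P W.
  have /compact_near_coveringP := fcpt t.
  apply => s /= fs.
  have : nbhs (s, z) (~` R).
    apply: open_nbhs_nbhs; split; first by rewrite openC.
    by move=> /= Rsz; apply: nR; exists (s, z) => //=; rewrite fs.
  case=> -[A B] /= [sA zB] AB.
  exists (A°, [set W | W `<=` B]) => /=.
    split; first exact: nbhs_interior.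
    exact: (small_set_sub zB).
  move=> [s' W] /= [As' WB]; apply: filterS As' => s'' As'' z' Wz'.
  by apply: (AB (s'', z')); split => //=; exact: WB.
have /near_powerset_filter_fromP[|W zW fP] := nP.
  by move=> A B AB H s /H; apply: filterS => s' H' z' /AB; exact: H'.
have tN := perfect_tube pf fP.
have [_ [/= [[s z'] Rsz' <-] [/= Ns Wz']]] :
    ([set (f p.1, p.2) | p in R] `&` (([set t' |
    forall s, f s = t' -> forall z', W z' -> ~ R (s, z')]) `*` W)) !=set0.
  by apply: cltz; exists ([set t' | forall s, f s = t' ->
    forall z', W z' -> ~ R (s, z')], W); first by split; [exact: tN|exact: zW].
exact: (Ns s erefl z' Wz' Rsz').
Qed.

Lemma swap_closed (S T : topologicalType) (R : set (S * T)) :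
  closed R -> closed [set (p.2, p.1) | p in R].
Proof.
have -> : [set (p.2, p.1) | p in R] = (fun p : T * S => (p.2, p.1)) @^-1` R.
  apply/seteqP; split => [_ [[a b] Rab <-] //|[b a] /= Rab].
  by exists (a, b).
apply: preimage_closed => p _; exact: swap_continuous.
Qed.

Lemma perfect_square_closed (S T : topologicalType) (f : S -> T)
    (R : set (S * S)) : perfect_map f -> closed R ->
  closed [set (f p.1, f p.2) | p in R].
Proof.
move=> pf cR.
have -> : [set (f p.1, f p.2) | p in R] = [set (p.2, p.1) | p in
    [set (f p.1, p.2) | p in [set (p.2, p.1) | p in
      [set (f p.1, p.2) | p in R]]]].
  apply/seteqP; split => [_ [[a b] Rab <-]|].
    exists (f b, f a) => //; exists (b, f a) => //; exists (f a, b) => //.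
    by exists (a, b).
  by move=> _ [_ [_ [_ [[a b] Rab <-] <-] <-] <-]; exists (a, b).
apply/swap_closed/perfect_id_closed => //.
exact/swap_closed/perfect_id_closed.
Qed.

Section graph_compactification.
Context (G : topGroupType) (X : tychonoffType) (r : rep G X).

Definition graph_embed (g : G) : hyperspace (X * X)%type :=
  Hyperspace (graph_closed (@tychonoff_hausdorff X) (@rep_continuous _ _ r g)).

(* b_X G, as a subset of 2^(X * X); coerced to a type it carries the subspace
   topology *)
Definition bG : set (hyperspace (X * X)%type) := closure (range graph_embed).

Lemma bG_graph g : graph_embed g \in bG.
Proof. by apply/mem_set/subset_closure; exists g. Qed.

Definition bG_map (g : G) : bG := exist _ (graph_embed g) (bG_graph g).

(* [bG] is automatically compact Hausdorff when X is locally compact, and the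
   image of G is dense in it. *)
Definition graph_compactification := embedding graph_embed.

Lemma theta_up_closed g (R : hyperspace (X * X)%type) :
  closed [set (p.1, r g p.2) | p in hset R].
Proof.
have -> : [set (p.1, r g p.2) | p in hset R] =
    (fun p : X * X => (p.1, r g^-1%g p.2)) @^-1` hset R.
  apply/seteqP; split => [_ [[a b] Rab <-]/=|[a b] /= Rab].
    by rewrite -rep_actM mulVg rep_act1.
  by eexists; first exact: Rab; rewrite /= -rep_actM mulgV rep_act1.
apply: preimage_closed; last exact: hset_closed.
move=> p _; apply: cvg_pair; first exact: cvg_fst.
by apply: cvg_comp; [exact: cvg_snd|exact: rep_continuous].
Qed.

Lemma theta_right_closed g (R : hyperspace (X * X)%type) :
  closed [set (r g p.1, p.2) | p in hset R].
Proof.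
have -> : [set (r g p.1, p.2) | p in hset R] =
    (fun p : X * X => (r g^-1%g p.1, p.2)) @^-1` hset R.
  apply/seteqP; split => [_ [[a b] Rab <-]/=|[a b] /= Rab].
    by rewrite -rep_actM mulVg rep_act1.
  by eexists; first exact: Rab; rewrite /= -rep_actM mulgV rep_act1.
apply: preimage_closed; last exact: hset_closed.
move=> p _; apply: cvg_pair; last exact: cvg_snd.
by apply: cvg_comp; [exact: cvg_fst|exact: rep_continuous].
Qed.

Definition theta_up g R : hyperspace (X * X)%type :=
  Hyperspace (@theta_up_closed g R).
Definition theta_right g R : hyperspace (X * X)%type :=
  Hyperspace (@theta_right_closed g R).

End graph_compactification.

Definition SH (T : topologicalType) (R : hyperspace (T * T)%type) :
    hyperspace (T * T)%type :=
  Hyperspace (swap_closed (@hset_closed _ R)).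

Definition FH (S T : topologicalType) (f : S -> T) (pf : perfect_map f)
    (R : hyperspace (S * S)%type) : hyperspace (T * T)%type :=
  Hyperspace (perfect_square_closed pf (@hset_closed _ R)).

Definition cond_PM (G : topGroupType) (Y : tychonoffType) (rY : rep G Y)
    (T : topologicalType) (f : Y -> T) (pf : perfect_map f) :=
  forall (g : G) R, bG rY R ->
    FH pf (graph_embed rY g) = FH pf R -> graph_embed rY g = R.

Definition zeroK (G : topGroupType) (Y : tychonoffType) (rY : rep G Y)
    (K : set Y) : set (hyperspace (Y * Y)%type) :=
  [set R | bG rY R /\ hset R `<=` (setT `*` K) `|` (K `*` setT)].

(* the part of R off the strips T x K and K x T *)
Definition off (T : Type) (K : set T) (R : set (T * T)) :=
  R `&` ((~` K) `*` (~` K)).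

Definition cond_EPM (G : topGroupType) (Y : tychonoffType) (rY : rep G Y)
    (T : topologicalType) (f : Y -> T) (pf : perfect_map f) (K : set Y) :=
  forall R S, bG rY R -> bG rY S ->
    (off K R = off K S -> off K R !=set0 -> FH pf R = FH pf S -> R = S) /\
    (off K R = off K S -> off K R = set0 -> FH pf R = FH pf S).

(* Main.v *)
(* The hyperspaces are compact Hausdorff, and F^H is continuous because f x f is
   perfect; as F^H maps the graph of g in Y onto the graph of g in X, it restricts
   to a continuous closed surjection b_Y G -> b_X G.  Hence the topology that b_X G
   induces on G is the given one exactly when no remainder point R of b_Y G is
   identified with a graph, which is (PM).  If f is injective off K, then F^H(R)
   determines the part of R off the strips over K; so every fibre of F^H is either
   contained in 0_K or disjoint from it, and (EPM) says that F^H is injective off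
   0_K and constant on 0_K. *)
Require Import Defs.
From HB Require Import structures.
From mathcomp Require Import all_boot all_order all_algebra.
From mathcomp Require Import finmap.
From mathcomp Require Import all_classical all_reals all_analysis.

Set Implicit Arguments.
Unset Strict Implicit.
Unset Printing Implicit Defensive.

Local Open Scope classical_set_scope.

(** * The Fell topology: compactness and separation *)

Lemma fell_subbase_open (T : topologicalType) (B : set (hyperspace T)) :
  fell_subbase B -> open B.
Proof.
move=> sB; exists [set B]; last by rewrite bigcup_set1.
move=> _ ->; exists [fset B]%fset; first by move=> C /fset1P ->; exact/mem_set.
by rewrite set_fset1 bigcap_set1.
Qed.

Lemma fell_cvg (T : topologicalType) (F : set_system (hyperspace T))
    (R : hyperspace T) : Filter F ->
  (forall B, fell_subbase B -> B R -> F B) -> F --> R.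
Proof.
move=> FF FB A [_ [[D sD <-] [C DC CR] CA]].
apply: filterS CA _; apply: (@filterS _ _ _ C); first by move=> S CS; exists C.
have [E sE EC] := sD _ DC; rewrite -EC; apply: filter_bigI => B EB.
by apply: FB; [have := sE _ EB; rewrite inE|move: CR; rewrite -EC; exact].
Qed.

Lemma fell_continuous (S T : topologicalType) (h : S -> hyperspace T) :
  (forall B, fell_subbase B -> open (h @^-1` B)) -> continuous h.
Proof.
move=> oh s; apply: fell_cvg => B sB Bs.
by apply: open_nbhs_nbhs; split => //; exact: oh.
Qed.

(* An ultrafilter converges to the set of the points all of whose
   neighbourhoods are hit by almost all members. *)
Lemma fell_compact (T : topologicalType) : compact [set: hyperspace T].
Proof.
rewrite compact_ultra => F FU _; have FF : Filter F by exact: filter_filter.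
pose hit W := [set R : hyperspace T | R `&` W !=set0].
pose L := [set p : T | forall W, open W -> W p -> F (hit W)].
have cL : closed L.
  move=> p clp W oW Wp; have [q [Lq Wq]] := clp W (open_nbhs_nbhs (conj oW Wp)).
  exact: Lq.
exists (Hyperspace cL); split=> //; apply: fell_cvg => B.
case=> [[W oW ->] [p [/= Lp Wp]]|[C cC -> LC]]; first exact: Lp.
(* As [F] is an ultrafilter, an open set not hit by almost all members is missed by almost all;
   compactness of [C] then makes the missing uniform over [C]. *)
have nearC : forall p, C p -> \forall q \near p & R \near F, ~ hset R q.
  move=> p Cp.
  have /existsNP[W /not_implyP[oW /not_implyP[Wp nFW]]] : ~ L p.
    by move=> Lp; have : (L `&` C) p by []; rewrite LC.
  exists (W, ~` hit W) => /=.
    split; first exact: open_nbhs_nbhs.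
    by have [] := in_ultra_setVsetC (hit W) FU.
  by move=> [q R] /= [Wq nR] Rq; apply: nR; exists q.
have FC := (compact_near_coveringP C).1 cC _ F (fun R p => ~ hset R p) FF nearC.
apply: (filterS _ FC) => R RC /=; rewrite -subset0 => p [Rp Cp]; exact: RC Cp Rp.
Qed.

(** [locally_compact] provides one compact neighbourhood per point; separating closed sets in the
    Fell topology takes arbitrarily small ones. *)
Definition compact_nbhs_base (T : topologicalType) :=
  forall (t : T) U, nbhs t U -> exists K, [/\ nbhs t K, compact K & K `<=` U].

Lemma locally_compact_nbhs_base (T : topologicalType) :
  hausdorff_space T -> locally_compact [set: T] -> compact_nbhs_base T.
Proof.
move=> hT lcT t U tU; have [V tV [cV _]] := lcT t I.
rewrite withinET in tV.
have [W tW WU] := compact_regular hT cV tV tU.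
exists (V `&` closure W); split; last by move=> s [_ /WU].
  by apply: filterI => //; apply: filterS tW; exact: subset_closure.
by apply: compact_closedI => //; exact: closed_closure.
Qed.

Lemma compact_nbhs_baseX (S T : topologicalType) :
  compact_nbhs_base S -> compact_nbhs_base T ->
  compact_nbhs_base (S * T)%type.
Proof.
move=> bS bT [s t] U [[A B] /= [sA tB] ABU].
have [K [sK cK KA]] := bS _ _ sA; have [L [tL cL LB]] := bT _ _ tB.
exists (K `*` L); split; [by exists (K, L)|exact: compact_setX|].
by move=> [a b] [/= /KA Aa /LB Bb]; exact: ABU.
Qed.

(** A point of [R] outside [S] has a compact neighbourhood [K] missing [S]; hitting the interior of
    [K] and missing [K] are disjoint subbasic conditions, true of [R] and [S] respectively. *)
Lemma fell_hausdorff (T : topologicalType) :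
  compact_nbhs_base T -> hausdorff_space (hyperspace T).
Proof.
move=> bT R S RS; apply: hyperspace_eq.
wlog suff sub: R S RS / hset R `<=` hset S.
  by apply/seteqP; split; apply: sub => // A B nA nB;
    rewrite setIC; apply: RS.
move=> p Rp; apply: contrapT => nSp.
have [|K [pK cK KS]] := bT p (~` hset S).
  by apply: open_nbhs_nbhs; split => //; rewrite openC; exact: hset_closed.
have [||Q [[q [Qq Kq]] QK]] :=
    RS [set F | F `&` K° !=set0] [set F | F `&` K = set0].
- apply: open_nbhs_nbhs; split; last by exists p.
  by apply: fell_subbase_open; left; exists K° => //; exact: open_interior.
- apply: open_nbhs_nbhs; split; first by apply: fell_subbase_open; right; exists K.
  by rewrite /= -subset0 => q [Sq /KS].
suff : set0 q by [].
by rewrite -QK; split => //; exact: interior_subset.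
Qed.

(** * Perfect maps and the maps they induce on hyperspaces *)

(** The image filter clusters at some [t] in [K]. If [F] had no cluster point on the compact fibre
    over [t], one member of [F] would stay away from the whole fibre, and by the tube lemma its
    image would miss a neighbourhood of [t]. *)
Lemma perfect_compact_preimage (S T : topologicalType) (f : S -> T)
    (K : set T) : perfect_map f -> compact K -> compact (f @^-1` K).
Proof.
move=> pf cK F FF FK; have [fc _ fcpt] := pf.
have [t [Kt clt]] := cK (f @ F) _ FK.
apply: contrapT => nF.
(* The parameter runs over small members of [F], so that compactness of the fibre yields a single
   member serving all its points. *)
have nearF s : (f @^-1` [set t]) s ->
    \forall s' \near s & A \near powerset_filter_from F, nbhs s' (~` A).
  move=> fs; have : ~ cluster F s.
    by move=> Fs; apply: nF; exists s; split => //=; rewrite fs.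
  move=> /existsNP[A /existsNP[B /not_implyP[FA /not_implyP[sB AB]]]].
  exists (B°, [set A' | F A' /\ A' `<=` A]) => /=.
    by split; [exact: nbhs_interior|exact: powerset_filter_fromP].
  move=> [s' A'] /= [Bs' [_ A'A]]; apply: filterS Bs' => s'' Bs'' /A'A As''.
  by apply: AB; exists s''.
have FA := (compact_near_coveringP _).1 (fcpt t) _ (powerset_filter_from F)
  (fun A s => nbhs s (~` A)) (powerset_filter_from_filter FF) nearF.
have /near_powerset_filter_fromP[|A FA' tA] := FA.
  by move=> A B AB H s /H; apply: filterS; exact: subsetC.
have [_ [[s As <-] /(_ s erefl)]] := clt (f @` A) _
  (filterS (@preimage_image _ _ f A) FA') (perfect_tube pf tA).
exact.
Qed.

Lemma perfect_square (S T : topologicalType) (f : S -> T) :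
  perfect_map f -> perfect_map (fun p : S * S => (f p.1, f p.2)).
Proof.
move=> pf; have [fc _ fcpt] := pf; split.
- move=> p; apply: cvg_pair; apply: cvg_comp; try exact: fc.
    exact: cvg_fst.
  exact: cvg_snd.
- by move=> R; exact: perfect_square_closed.
- move=> [a b].
  have -> : (fun p : S * S => (f p.1, f p.2)) @^-1` [set (a, b)] =
      (f @^-1` [set a]) `*` (f @^-1` [set b]).
    by apply/seteqP; split => -[s s'] /= [-> ->].
  exact: compact_setX.
Qed.

(** Hitting [W] pulls back to hitting [p @^-1] W[, and missing]K[to missing]p @^-1[K]: the two
    assumptions on [p] match the two kinds of subbasic sets. *)
Lemma hyperspace_image_continuous (S T : topologicalType) (p : S -> T)
    (h : hyperspace S -> hyperspace T) :
  continuous p -> (forall K, compact K -> compact (p @^-1` K)) ->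
  (forall R, hset (h R) = p @` hset R) -> continuous h.
Proof.
move=> pc pK hE; apply: fell_continuous => B [[W oW ->]|[K cK ->]];
  apply: fell_subbase_open.
- left; exists (p @^-1` W); first exact: open_comp.
  apply/seteqP; split => R /=; rewrite hE.
    by move=> [_ [[s Rs <-] Ws]]; exists s.
  by move=> [s [Rs Ws]]; exists (p s); split => //; exists s.
- right; exists (p @^-1` K); first exact: pK.
  apply/seteqP; split => R /=; rewrite hE -!subset0 => RK.
    by move=> s [Rs Ks]; apply: (RK (p s)); split => //; exists s.
  by move=> _ [[s Rs <-] Ks]; apply: (RK s).
Qed.

Lemma continuous_homeo_compact_preimage (S T : topologicalType) (p : S -> T)
    (q : T -> S) (K : set T) :
  continuous q -> cancel p q -> cancel q p -> compact K ->
  compact (p @^-1` K).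
Proof.
move=> qc pK qK cK; have -> : p @^-1` K = q @` K.
  apply/seteqP; split => [s Ks|_ [t Kt <-]] /=; last by rewrite qK.
  by exists (p s); rewrite ?pK.
by apply: continuous_compact => //; exact: continuous_subspaceT.
Qed.

(** * Graphs of group elements, translations and inversion *)

Section rep_theory.
Context (G : topGroupType) (X : tychonoffType) (r : rep G X).

Lemma rep_actK g : cancel (r g) (r g^-1%g).
Proof. by move=> x; rewrite -rep_actM mulVg rep_act1. Qed.

Lemma rep_actVK g : cancel (r g^-1%g) (r g).
Proof. by move=> x; rewrite -rep_actM mulgV rep_act1. Qed.

Lemma graph_embed_inj : injective (graph_embed r).
Proof.
move=> g h /(congr1 (@hset _)) /= gh; apply: (@rep_inj _ _ r).
apply/funext => x.
have : [set (x, r h x) | x in setT] (x, r g x) by rewrite -gh; exists x.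
by move=> [_ _ [-> ->]].
Qed.

(** By effectiveness [g] is determined by its values at [a] and [b], which leaves finitely many
    choices. This serves the degenerate case where a graph lies in the strips over [K]. *)
Lemma rep_two_points_finite (a b : X) :
  (forall x, x = a \/ x = b) -> finite_set [set: G].
Proof.
move=> ab; have -> : [set: G] =
    (fun g => (r g a, r g b)) @^-1` ([set a; b] `*` [set a; b]).
  by apply/seteqP; split => // g _; split; exact: ab.
apply: finite_preimage; last exact: finite_setX.
move=> g h _ _ [gha ghb]; apply: (@rep_inj _ _ r); apply/funext => x.
by case: (ab x) => ->.
Qed.

Lemma compact_bG : compact (bG r).
Proof.
by apply: subclosed_compact (@fell_compact _) _ => //; exact: closed_closure.
Qed.

Lemma theta_up_graph g h :
  theta_up r g (graph_embed r h) = graph_embed r (g * h)%g.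
Proof.
apply: hyperspace_eq; apply/seteqP; split.
  by move=> _ [_ [x _ <-] <-]; exists x; rewrite ?rep_actM.
by move=> _ [x _ <-]; exists (x, r h x); [exists x|rewrite rep_actM].
Qed.

Lemma theta_right_graph g h :
  theta_right r g (graph_embed r h) = graph_embed r (h * g^-1)%g.
Proof.
apply: hyperspace_eq; apply/seteqP; split.
  by move=> _ [_ [x _ <-] <-]; exists (r g x); rewrite ?rep_actM ?rep_actK.
move=> _ [x _ <-]; exists (r g^-1%g x, r h (r g^-1%g x)).
  by exists (r g^-1%g x).
by rewrite /= rep_actVK rep_actM.
Qed.

Lemma SH_graph h : SH (graph_embed r h) = graph_embed r h^-1%g.
Proof.
apply: hyperspace_eq; apply/seteqP; split.
  by move=> _ [_ [x _ <-] <-]; exists (r h x); rewrite ?rep_actK.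
move=> _ [x _ <-]; exists (r h^-1%g x, x) => //.
by exists (r h^-1%g x); rewrite ?rep_actVK.
Qed.

Lemma theta_up_continuous g : continuous (theta_up r g).
Proof.
have c k : continuous (fun p : X * X => (p.1, r k p.2)).
  move=> p; apply: cvg_pair; first exact: cvg_fst.
  by apply: cvg_comp; [exact: cvg_snd|exact: rep_continuous].
apply: (hyperspace_image_continuous (c g)) => // K.
apply: (continuous_homeo_compact_preimage (c g^-1%g)) => -[a b] /=.
  by rewrite rep_actK.
by rewrite rep_actVK.
Qed.

Lemma theta_right_continuous g : continuous (theta_right r g).
Proof.
have c k : continuous (fun p : X * X => (r k p.1, p.2)).
  move=> p; apply: cvg_pair; last exact: cvg_snd.
  by apply: cvg_comp; [exact: cvg_fst|exact: rep_continuous].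
apply: (hyperspace_image_continuous (c g)) => // K.
apply: (continuous_homeo_compact_preimage (c g^-1%g)) => -[a b] /=.
  by rewrite rep_actK.
by rewrite rep_actVK.
Qed.

End rep_theory.

Lemma SH_continuous (T : topologicalType) : continuous (@SH T).
Proof.
have c : continuous (fun p : T * T => (p.2, p.1)).
  by move=> p; exact: swap_continuous.
apply: (hyperspace_image_continuous c) => // K.
by apply: (continuous_homeo_compact_preimage c) => -[].
Qed.

Lemma FH_continuous (S T : topologicalType) (f : S -> T)
    (pf : perfect_map f) : continuous (FH pf).
Proof.
have [c _ _] := perfect_square pf.
apply: (hyperspace_image_continuous c) => // K.
exact/perfect_compact_preimage/perfect_square.
Qed.

(** Reduces invariance of the closure to a check on graphs; applied to [FH], [SH] and both
    translations. *)
Lemma bG_image (G : topGroupType) (Y X : tychonoffType) (rY : rep G Y)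
    (rX : rep G X) (h : hyperspace (Y * Y)%type -> hyperspace (X * X)%type)
    R :
  continuous h -> (forall g, exists k, h (graph_embed rY g) = graph_embed rX k) ->
  bG rY R -> bG rX (h R).
Proof.
move=> hc hg bR B /hc/bR [_ [[g _ <-] /= Bg]].
by exists (h (graph_embed rY g)); split => //; have [k ->] := hg g; exists k.
Qed.

(** * Comparison of the graph closures over [Y] and [X], and condition (PM) *)

Section graph_comparison.
Context (G : topGroupType) (Y X : tychonoffType) (rY : rep G Y) (rX : rep G X)
  (f : Y -> X) (pf : perfect_map f).
Context (Y_lc : locally_compact [set: Y]) (X_lc : locally_compact [set: X])
  (f_onto : set_surj setT setT f)
  (f_equivariant : forall g y, f (rY g y) = rX g (f y)).

Let YY_hausdorff : hausdorff_space (hyperspace (Y * Y)%type).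
Proof.
by apply/fell_hausdorff/compact_nbhs_baseX; apply: locally_compact_nbhs_base;
  [exact: tychonoff_hausdorff| |exact: tychonoff_hausdorff|].
Qed.

Let XX_hausdorff : hausdorff_space (hyperspace (X * X)%type).
Proof.
by apply/fell_hausdorff/compact_nbhs_baseX; apply: locally_compact_nbhs_base;
  [exact: tychonoff_hausdorff| |exact: tychonoff_hausdorff|].
Qed.

Lemma FH_graph g : FH pf (graph_embed rY g) = graph_embed rX g.
Proof.
apply: hyperspace_eq; apply/seteqP; split.
  by move=> _ [_ [y _ <-] <-]; exists (f y); rewrite //= f_equivariant.
move=> _ [x _ <-]; have [y _ <-] : range f x by exact: f_onto.
by exists (y, rY g y); [exists y|rewrite /= f_equivariant].
Qed.

Lemma FH_bG R : bG rY R -> bG rX (FH pf R).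
Proof.
apply: bG_image; first exact: FH_continuous.
by move=> g; exists g; exact: FH_graph.
Qed.

(** [bG rY] is compact and the target is Hausdorff. Surjectivity, the quotient property and the
    sufficiency of (PM) all rest on this. *)
Lemma FH_closed (C : set (hyperspace (Y * Y)%type)) :
  closed C -> closed (FH pf @` (C `&` bG rY)).
Proof.
move=> cC; apply: compact_closed => //; apply: continuous_compact.
  exact/continuous_subspaceT/FH_continuous.
by rewrite setIC; apply: compact_closedI => //; exact: compact_bG.
Qed.

Lemma FH_bG_surj S : bG rX S -> exists2 R, bG rY R & FH pf R = S.
Proof.
move=> bS; suff [R [_ bR] RS] : (FH pf @` (setT `&` bG rY)) S by exists R.
apply: (FH_closed closedT); apply: closureS bS => _ [g _ <-].
exists (graph_embed rY g); last exact: FH_graph.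
by split => //; apply: subset_closure; exists g.
Qed.

Definition FH_bG_map (R : bG rY) : bG rX :=
  exist _ (FH pf (set_val R)) (mem_set (FH_bG (set_mem (valP R)))).

Lemma FH_bG_map_graph : comp_map (bG_map rY) (bG_map rX) FH_bG_map.
Proof.
split; last by move=> g; apply: val_inj; exact: FH_graph.
apply: continuous_comp_initial.
apply/continuousP => W oW; exists (FH pf @^-1` W) => //.
by apply: open_comp => // R _; exact: FH_continuous.
Qed.

Lemma FH_bG_map_quotient : quotient_map FH_bG_map.
Proof.
split; first by have [] := FH_bG_map_graph.
  move=> S _; have [R bR RS] := FH_bG_surj (set_mem (valP S)).
  by exists (exist _ R (mem_set bR)) => //; exact: val_inj.
move=> V [W oW WV].
(* [W] cuts out the preimage of [V] in [bG rY], so the image of its complement cuts out the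
   complement of [V] in [bG rX]. *)
exists (~` (FH pf @` (~` W `&` bG rY))).
  by rewrite openC; apply: FH_closed; rewrite closedC.
apply/seteqP; split => S /=.
  have [R bR RS] := FH_bG_surj (set_mem (valP S)).
  have -> : S = FH_bG_map (exist _ R (mem_set bR)) by exact: val_inj.
  move=> nS; have : (FH_bG_map @^-1` V) (exist _ R (mem_set bR)).
    by rewrite -WV /=; apply: contrapT => nW; apply: nS; exists R.
  exact.
move=> VS [R [nWR bR] RS]; apply: nWR.
have : (FH_bG_map @^-1` V) (exist _ R (mem_set bR)).
  by rewrite /=; have -> : FH_bG_map (exist _ R (mem_set bR)) = S by exact: val_inj.
by rewrite -WV.
Qed.

(** Both embeddings induce the same topology on [G], so a neighbourhood of the graph of [g] over [Y]
    is cut out on [G] by some open [V] over [X]. Graphs near [R] have images in [V], hence lie in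
    that neighbourhood; so [R] cannot be separated from the graph of [g]. *)
Lemma graph_compactification_PM :
  graph_compactification rY -> graph_compactification rX -> cond_PM rY pf.
Proof.
move=> [_ Yc _] [_ _ Xo] g R bR gR; apply: YY_hausdorff => A B.
rewrite !nbhsE => -[A' [oA' A'g] A'A] [B' [oB' B'R] B'B].
have [V oV AV] := Xo _ (open_comp (fun h _ => Yc h) oA').
have : V (graph_embed rX g) by have : (graph_embed rY @^-1` A') g by []; rewrite AV.
rewrite -FH_graph gR => VR.
have [|_ [[h _ <-] [B'h Vh]]] := bR (B' `&` FH pf @^-1` V).
  apply: filterI; first exact: open_nbhs_nbhs.
  by apply: (FH_continuous (pf := pf)); exact: open_nbhs_nbhs.
exists (graph_embed rY h); split; last exact: B'B.
apply: A'A; suff : (graph_embed rY @^-1` A') h by [].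
by rewrite AV; move: Vh; rewrite /= FH_graph.
Qed.

Lemma PM_graph_compactification :
  graph_compactification rY -> cond_PM rY pf -> graph_compactification rX.
Proof.
move=> [_ Yc Yo] pm; split; first exact: graph_embed_inj.
  have -> : graph_embed rX = FH pf \o graph_embed rY.
    by apply/funext => g; rewrite /= FH_graph.
  by move=> g; apply: continuous_comp; [exact: Yc|exact: FH_continuous].
(* The removed set is closed, and by (PM) it contains no graph of a [g] whose graph over [Y] lies in
   [V]. *)
move=> _ /Yo[V oV ->]; exists (~` (FH pf @` (~` V `&` bG rY))).
  by rewrite openC; apply: FH_closed; rewrite closedC.
apply/seteqP; split => g /=; last first.
  move=> ng; apply: contrapT => nV; apply: ng; exists (graph_embed rY g).
    by split => //; apply: subset_closure; exists g.
  exact: FH_graph.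
move=> Vg [R [nVR bR]]; rewrite -FH_graph => /esym/pm gR.
by apply: nVR; rewrite -gR.
Qed.

(** * Elementary maps, the set [zeroK] and condition (EPM) *)

Section elementary_map.
Context (x : X).
Context (f_inj : forall x', x' <> x -> exists! y, f y = x').
Let K := f @^-1` [set x].

Lemma fibre_unique y y' : ~ K y -> f y' = f y -> y' = y.
Proof.
by move=> nKy fy; have [z [_ zu]] := f_inj nKy; rewrite -(zu y') // -(zu y).
Qed.

Lemma FH_off (R S : hyperspace (Y * Y)%type) :
  FH pf R = FH pf S -> off K (hset R) = off K (hset S).
Proof.
suff sub (P Q : hyperspace (Y * Y)%type) :
    FH pf P = FH pf Q -> off K (hset P) `<=` off K (hset Q).
  by move=> RS; apply/seteqP; split; apply: sub.
move=> PQ [a b] [Pab [/= nKa nKb]]; split => //.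
have : hset (FH pf P) (f a, f b) by exists (a, b).
rewrite PQ => -[[a' b'] Qab [fa fb]].
by rewrite -(fibre_unique nKa fa) -(fibre_unique nKb fb).
Qed.

(** Matches membership in [zeroK] with the case distinction of (EPM). *)
Lemma zeroKE R : zeroK rY K R <-> bG rY R /\ off K (hset R) = set0.
Proof.
split=> -[bR RK]; split => //.
  by rewrite -subset0 => -[a b] [/RK[[_ Kb]|[Ka _]] [/= nKa nKb]].
move=> [a b] Rab; apply: contrapT => nK.
suff : set0 (a, b) by []; rewrite -RK; split => //.
by split => ?; apply: nK; [right|left].
Qed.

(** If [g] moved [x], it would carry [K] injectively into a one-point fibre, so [K] would have at
    most one point. For such a [K] the point [x] is not singled out by [f], and its being fixed is
    assumed instead. *)
Lemma fibre_invariant :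
  ~ is_subset1 K \/ (forall g, rX g x = x) -> forall g y, K y -> K (rY g y).
Proof.
move=> fixx g y /= fy; rewrite /K /= f_equivariant fy.
case: fixx => [nK|//]; apply: contrapT => gx; apply: nK => y1 y2 /= fy1 fy2.
have gK z : f z = x -> ~ K (rY g z) by move=> fz; rewrite /K /= f_equivariant fz.
apply: (can_inj (rep_actK rY g)); apply: fibre_unique; first exact: gK.
by rewrite !f_equivariant fy1 fy2.
Qed.

Lemma zeroK_invariant : (forall g y, K y -> K (rY g y)) ->
  [/\ forall g R, zeroK rY K R -> zeroK rY K (theta_up rY g R),
      forall R, zeroK rY K R -> zeroK rY K (SH R) &
      forall g R, zeroK rY K R -> zeroK rY K (theta_right rY g R)].
Proof.
move=> gK; split.
- move=> g R [bR RK]; split.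
    apply: bG_image bR; first exact: theta_up_continuous.
    by move=> h; exists (g * h)%g; exact: theta_up_graph.
  by move=> _ [[a b] /RK[[_ Kb]|[Ka _]] <-]; [left; split => //; exact: gK|right].
- move=> R [bR RK]; split.
    apply: bG_image bR; first exact: SH_continuous.
    by move=> h; exists h^-1%g; exact: SH_graph.
  by move=> _ [[a b] /RK[[_ Kb]|[Ka _]] <-]; [right|left].
- move=> g R [bR RK]; split.
    apply: bG_image bR; first exact: theta_right_continuous.
    by move=> h; exists (h * g^-1)%g; exact: theta_right_graph.
  by move=> _ [[a b] /RK[[_ Kb]|[Ka _]] <-]; [left|right; split => //; exact: gK].
Qed.

(* If the graph of g lies in the strips, then X = {x, g^-1 x}, so G is finite
   and bG consists of graphs only. *)
Lemma EPM_PM : cond_EPM rY pf K -> cond_PM rY pf.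
Proof.
move=> epm g R bR gR; have offE := FH_off gR.
have bg : bG rY (graph_embed rY g) by apply: subset_closure; exists g.
have [off0|/set0P off0] := eqVneq (off K (hset (graph_embed rY g))) set0;
  last exact: (epm _ _ bg bR).1.
(* Any other [x' = f y] would put [(y, rY g y)] off the strips. *)
have two x' : x' = x \/ x' = rX g^-1%g x.
  have [y _ <-] : range f x' by exact: f_onto.
  apply: contrapT => /not_orP[fy gfy].
  suff : set0 (y, rY g y) by [].
  rewrite -off0; split; first by exists y.
  split => //=; rewrite /K /= f_equivariant => gx; apply: gfy.
  by rewrite -gx rep_actK.
(* A finite set of graphs is its own closure, so [R] is the graph of some [h], and effectiveness on
   [X] gives [h = g]. *)
have cG : closed (range (graph_embed rY)).
  apply: accessible_finite_set_closed.1; first exact: hausdorff_accessible.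
  exact/finite_image/(rep_two_points_finite rX two).
have [h _ hR] : range (graph_embed rY) R by exact: cG.
by move: gR; rewrite -hR !FH_graph => /graph_embed_inj ->.
Qed.

(** The first clause of (EPM) gives injectivity off [zeroK], its assumption on the parts off the
    strips coming from [FH_off]; the second collapses [zeroK]. *)
Lemma EPM_elementary : cond_EPM rY pf K ->
  elementary_with_fibre FH_bG_map [set R | zeroK rY K (set_val R)].
Proof.
move=> epm.
have bval (R : bG rY) : bG rY (set_val R) := set_mem (valP R).
have FHE R S : FH_bG_map R = FH_bG_map S ->
    FH pf (set_val R) = FH pf (set_val S) by move/(congr1 set_val).
have inj (R S : bG rY) : ~ zeroK rY K (set_val R) ->
    FH_bG_map R = FH_bG_map S -> R = S.
  move=> nR RS; apply: val_inj; apply: (epm _ _ (bval R) (bval S)).1.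
  - exact/FH_off/FHE.
  - by apply/set0P/eqP => off0; apply: nR; apply/zeroKE.
  - exact: FHE.
have sub1 : is_subset1 (FH_bG_map @` [set R | zeroK rY K (set_val R)]).
  move=> _ _ [R /zeroKE[bR R0] <-] [S /zeroKE[bS S0] <-]; apply: val_inj.
  by apply: (epm _ _ bR bS).2; rewrite ?R0 ?S0.
split => //; last by move=> R S /set_mem nR _; exact: inj.
split; first exact: FH_bG_map_quotient.
have [_ surj _] := FH_bG_map_quotient.
(* A preimage outside [zeroK] is the only one, so every exceptional value comes from [zeroK], whose
   image has at most one point. *)
have fibre S : ~ (exists! R, FH_bG_map R = S) ->
    (FH_bG_map @` [set R | zeroK rY K (set_val R)]) S.
  move=> nS; have [R _ RS] : range FH_bG_map S by exact: surj.
  exists R => //; apply: contrapT => nR; apply: nS; exists R; split => // R' R'S.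
  by apply: inj => //; rewrite RS.
by move=> S T /fibre ? /fibre; exact: sub1.
Qed.

(** The two clauses of (EPM) are read off from injectivity of [phi] outside [zeroK] and from the
    collapse of [zeroK], once [phi] is identified with [FH]. *)
Lemma elementary_EPM (phi : bG rY -> bG rX) :
  (forall R, set_val (phi R) = FH pf (set_val R)) ->
  elementary_with_fibre phi [set R | zeroK rY K (set_val R)] ->
  cond_EPM rY pf K.
Proof.
move=> phiE [_ phi_inj phi1] R S bR bS.
pose R' : bG rY := exist _ R (mem_set bR).
pose S' : bG rY := exist _ S (mem_set bS).
split=> offE off0.
  move=> RS; suff /(congr1 set_val) : R' = S' by [].
  apply: phi_inj.
  - by apply/mem_set => /zeroKE[_ /eqP]; apply/negP/set0P.
  - by apply/mem_set => /zeroKE[_ /eqP]; apply/negP/set0P; rewrite -offE.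
  - by apply: val_inj; rewrite -set_valE !phiE.
rewrite -(phiE R') -(phiE S'); congr set_val; apply: phi1.
  by exists R' => //; apply/zeroKE.
by exists S' => //; apply/zeroKE; split => //; rewrite -offE.
Qed.

End elementary_map.
End graph_comparison.

Theorem theorem3p25 (G : topGroupType) (Y X : tychonoffType)
    (rY : rep G Y) (rX : rep G X)
    (Y_lc : locally_compact [set: Y]) (X_lc : locally_compact [set: X])
    (rY_taug : taug_representable rY) (rX_taug : taug_representable rX)
    (f : Y -> X) (f_perfect : perfect_map f) (f_onto : set_surj setT setT f)
    (f_equivariant : forall g y, f (rY g y) = rX g (f y))
    (bY_graph : graph_compactification rY) :
  ((graph_compactification rX /\ comp_ge (bG_map rY) (bG_map rX)) <->
     cond_PM rY f_perfect) /\
  (forall (x : X) (K : set Y),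
     elementary f -> K = f @^-1` [set x] ->
     (forall x', x' <> x -> exists! y, f y = x') ->
     ((~ is_subset1 K \/ (forall g, rX g x = x)) ->
        [/\ forall g R, zeroK rY K R -> zeroK rY K (theta_up rY g R),
            forall R, zeroK rY K R -> zeroK rY K (SH R) &
            forall g R, zeroK rY K R -> zeroK rY K (theta_right rY g R)]) /\
     ([/\ graph_compactification rX,
          comp_ge (bG_map rY) (bG_map rX) &
          exists phi : bG rY -> bG rX,
            [/\ comp_map (bG_map rY) (bG_map rX) phi,
                forall R, set_val (phi R) = FH f_perfect (set_val R) &
                elementary_with_fibre phi
                  [set R | zeroK rY K (set_val R)]]] <->
      cond_EPM rY f_perfect K)).
Proof.
split; first split.
- by move=> [cX _]; exact: (graph_compactification_PM Y_lc f_onto f_equivariant).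
- move=> pm; split.
    exact: (PM_graph_compactification X_lc f_onto f_equivariant bY_graph pm).
  by exists (FH_bG_map f_perfect f_onto f_equivariant); exact: FH_bG_map_graph.
move=> x K _ -> f_inj; split.
  by move=> fixx; exact/zeroK_invariant/fibre_invariant.
split=> [[_ _ [phi [_ phiE phi_el]]]|epm]; first exact: elementary_EPM phi_el.
have phi_comp := FH_bG_map_graph f_perfect f_onto f_equivariant.
split; last by exists (FH_bG_map f_perfect f_onto f_equivariant); split => //;
  exact: EPM_elementary.
  apply: (PM_graph_compactification X_lc f_onto f_equivariant bY_graph).
  exact: EPM_PM epm.
by exists (FH_bG_map f_perfect f_onto f_equivariant).
Qed.
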